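(* Let $G\le\mathrm{Sym}(\Gamma)$ and $H\le\mathrm{Sym}(\Delta)$ be pre-primitive permutation groups on finite sets $\Gamma$ and $\Delta$. Suppose that every $(G\times H)$-invariant partition $\Pi$ of $\Gamma\times\Delta$ is of (at least) one of the following types: (i) the $G$-fibre partition induced by $\Pi$ on $\Gamma$ is the same as the $G$-projection partition, and the $H$-fibre partition induced by $\Pi$ on $\Delta$ is the same as the $H$-projection partition; (ii) the $G$-projection and $H$-projection partitions induced by $\Pi$ on $\Gamma$ and $\Delta$ respectively are the partitions with a single part. Then $G\times H$ in its product action on $\Gamma\times\Delta$ is pre-primitive.
   Context: The product action of $G\times H$ on $\Gamma\times\Delta$ is $(\gamma,\delta)(g,h)=(\gamma g,\delta h)$. A partition of $\Omega$ is $G$-invariant if every $g\in G$ maps each part onto a part. The orbit partition of a subgroup is the partition of $\Omega$ into its orbits. A transitive permutation group $G$ on a finite set $\Omega$ is pre-primitive if every $G$-invariant partition of $\Omega$ is the orbit partition of some subgroup of $G$. Let $G,H$ be transitive on $\Gamma,\Delta$ and let $\Pi$ be a $(G\times H)$-invariant partition of $\Gamma\times\Delta$. The $G$-projection partition of $\Gamma$ has as its parts the sets $P_0=\{\gamma\in\Gamma:(\exists\delta\in\Delta)\,(\gamma,\delta)\in P\}$ for $P$ a part of $\Pi$ (these sets form a partition of $\Gamma$). The $G$-fibre partition of $\Gamma$ is obtained by fixing $\delta\in\Delta$: its parts are the non-empty sets $\{\gamma\in\Gamma:(\gamma,\delta)\in P\}$ for $P$ a part of $\Pi$ (this is independent of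 the choice of $\delta$). The $H$-projection and $H$-fibre partitions of $\Delta$ are defined in the same way with the roles of the two coordinates exchanged. *)

(* Defs.v *)
From mathcomp Require Import all_boot all_fingroup.

Set Implicit Arguments.
Unset Strict Implicit.
Unset Printing Implicit Defensive.

Import GroupScope.

Definition prodact (aT bT : finGroupType) (S T : finType)
    (to1 : {action aT &-> S}) (to2 : {action bT &-> T})
    (x : S * T) (a : aT * bT) : S * T :=
  (to1 x.1 a.1, to2 x.2 a.2).

Lemma prodact_is_action (aT bT : finGroupType) (S T : finType)
    (to1 : {action aT &-> S}) (to2 : {action bT &-> T}) :
  is_action [set: aT * bT] (prodact to1 to2).
Proof.
apply: is_total_action => [[x y]|[x y] [a b] [c d]] /=.
  by rewrite /prodact /= !act1.
by rewrite /prodact /= !actM.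
Qed.

Canonical prod_action (aT bT : finGroupType) (S T : finType)
    (to1 : {action aT &-> S}) (to2 : {action bT &-> T}) :=
  Action (prodact_is_action to1 to2).

(* The permutation group G <= Sym(T) is the case to = 'P. *)
Definition invariant_partition (aT : finGroupType) (T : finType)
    (to : {action aT &-> T}) (A : {set aT}) (Pi : {set {set T}}) : Prop :=
  partition Pi [set: T] /\ [acts A, on Pi | to^*].

Definition orbit_partition (aT : finGroupType) (T : finType)
    (to : {action aT &-> T}) (K : {set aT}) : {set {set T}} :=
  [set orbit to K x | x : T].

Definition preprimitive (aT : finGroupType) (T : finType)
    (to : {action aT &-> T}) (A : {set aT}) : Prop :=
  [transitive A, on [set: T] | to] /\
  forall Pi : {set {set T}}, invariant_partition to A Pi ->
    exists K : {group aT}, K \subset A /\ Pi = orbit_partition to K.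

Section ProjectionFibre.

Variables (Gamma Delta : finType) (Pi : {set {set Gamma * Delta}}).

Definition projection1 : {set {set Gamma}} :=
  [set [set c | [exists d, (c, d) \in P]] | P : {set Gamma * Delta} in Pi].

Definition projection2 : {set {set Delta}} :=
  [set [set d | [exists c, (c, d) \in P]] | P : {set Gamma * Delta} in Pi].

Definition fibre1 (d : Delta) : {set {set Gamma}} :=
  [set [set c | (c, d) \in P] | P : {set Gamma * Delta} in Pi] :\ set0.

Definition fibre2 (c : Gamma) : {set {set Delta}} :=
  [set [set d | (c, d) \in P] | P : {set Gamma * Delta} in Pi] :\ set0.

(* The fibre partitions do not depend on the fixed coordinate when Pi is
   invariant and the groups are transitive: see fibre1_indep, fibre2_indep. *)
Definition type_i : Prop :=
  (forall d : Delta, fibre1 d = projection1) /\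
  (forall c : Gamma, fibre2 c = projection2).

Definition type_ii : Prop :=
  projection1 = [set [set: Gamma]] /\ projection2 = [set [set: Delta]].

End ProjectionFibre.

Lemma fibre1_indep (Gamma Delta : finType) (G : {group {perm Gamma}})
    (H : {group {perm Delta}}) (Pi : {set {set Gamma * Delta}}) :
  [transitive H, on [set: Delta] | 'P] ->
  invariant_partition (prod_action 'P 'P) (setX G H) Pi ->
  forall d d' : Delta, fibre1 Pi d = fibre1 Pi d'.
Proof.
move=> trH [_ actsPi].
suff sub d d' : fibre1 Pi d \subset fibre1 Pi d'.
  by move=> d d'; apply/eqP; rewrite eqEsubset !sub.
have [h Hh ->] := atransP2 trH (in_setT d) (in_setT d').
apply/setSD/subsetP => _ /imsetP[P PiP ->].
have GHh : (1, h) \in setX G H by rewrite inE /= group1.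
have := acts_act actsPi GHh P; rewrite PiP => PiPh.
apply/imsetP; exists (setact (prod_action 'P 'P) P (1, h)) => //.
apply/setP => c; rewrite !inE; apply/idP/imsetP => [Pcd | [[c1 d1] Pcd]].
  by exists (c, d) => //; rewrite /= /prodact /= /aperm perm1.
by rewrite /= /prodact /= /aperm perm1 => -[-> /perm_inj ->].
Qed.

Lemma fibre2_indep (Gamma Delta : finType) (G : {group {perm Gamma}})
    (H : {group {perm Delta}}) (Pi : {set {set Gamma * Delta}}) :
  [transitive G, on [set: Gamma] | 'P] ->
  invariant_partition (prod_action 'P 'P) (setX G H) Pi ->
  forall c c' : Gamma, fibre2 Pi c = fibre2 Pi c'.
Proof.
move=> trG [_ actsPi].
suff sub c c' : fibre2 Pi c \subset fibre2 Pi c'.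
  by move=> c c'; apply/eqP; rewrite eqEsubset !sub.
have [g Gg ->] := atransP2 trG (in_setT c) (in_setT c').
apply/setSD/subsetP => _ /imsetP[P PiP ->].
have GHg : (g, 1) \in setX G H by rewrite inE /= group1 andbT.
have := acts_act actsPi GHg P; rewrite PiP => PiPg.
apply/imsetP; exists (setact (prod_action 'P 'P) P (g, 1)) => //.
apply/setP => d; rewrite !inE; apply/idP/imsetP => [Pcd | [[c1 d1] Pcd]].
  by exists (c, d) => //; rewrite /= /prodact /= /aperm perm1.
by rewrite /= /prodact /= /aperm perm1 => -[/perm_inj -> ->].
Qed.

(* Main.v *)
Require Import Defs.
From mathcomp Require Import all_boot all_fingroup.

Set Implicit Arguments.
Unset Strict Implicit.
Unset Printing Implicit Defensive.

Import GroupScope.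

(** An invariant partition Pi of S x T of the first type consists of boxes: its
parts are products of a part of a G-invariant partition of S and a part of an
H-invariant partition of T.  If subgroups K1 of G and K2 of H realise these two
partitions as orbit partitions, then K1 x K2 realises Pi
([type_i_orbit_partition]).

For Pi of the second type the subgroup is the kernel of G x H acting on the set
of parts ([type_ii_orbit_partition]).  Full projections mean that every part
meets every line {c} x T and S x {d}, so that G and H are each transitive on
the parts; moreover their actions on the parts commute.  Hence both actions are
regular, and they are the two regular representations of one abstract group L.
If (c, d) and (c', d') lie in one part, choose g in G mapping c to c'.  Given h
in H such that (g, h) fixes every part, the images of (c, d) and (c', d') agree
up to moving the second coordinate inside a fibre of Pi, and an element of the
subgroup of H that realises the fibre partition makes that last correction.

Such an h exists for every g exactly when L is abelian, and this is where the
hypothesis is applied a second time: not to Pi but to its meet with the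
pull-back of an H-invariant partition Sigma of T.  That meet projects onto
Sigma, so if it is of the second type then Sigma has one part, and if it is of
the first type then Sigma refines the fibre partition of Pi
([invariant_kernel_dichotomy]).  Applied to the Sigma given by the orbits of
one element g of G on the parts, this says that g acts trivially on the parts
or that its powers are transitive on them ([trivial_or_cycle_transitive]); in
both cases h is easy to find ([kernel_lift]). *)

(** * Partitions and kernels of functions *)

Section Partitions.

Variables (T : finType) (Pi : {set {set T}}).
Hypothesis partPi : partition Pi [set: T].

Lemma mem_pblockT x : x \in pblock Pi x.
Proof. by rewrite mem_pblock (cover_partition partPi) inE. Qed.

Lemma pblock_partT x : pblock Pi x \in Pi.
Proof. by rewrite pblock_mem // (cover_partition partPi) inE. Qed.

Lemma pblockTE x P : P \in Pi -> x \in P -> pblock Pi x = P.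
Proof. by case/and3P: partPi => _ tiPi _; apply: def_pblock. Qed.

Lemma eq_pblockT x y : (pblock Pi x == pblock Pi y) = (y \in pblock Pi x).
Proof.
case/and3P: partPi => _ tiPi _; apply: eq_pblock => //.
by rewrite (cover_partition partPi) inE.
Qed.

End Partitions.

Lemma mem_preim_pblock (T : finType) (rT : eqType) (f : T -> rT) x y :
  (y \in pblock (preim_partition f [set: T]) x) = (f x == f y).
Proof.
rewrite pblock_equivalence_partition ?inE //.
by split=> // /eqP->.
Qed.

(** * Pre-primitivity in terms of invariant equivalence kernels *)

Section Actions.

Variables (aT : finGroupType) (T : finType) (to : {action aT &-> T}).
Implicit Type A : {group aT}.

Lemma pblock_act A Pi a x :
    invariant_partition to A Pi -> a \in A ->
  pblock Pi (to x a) = (to^*)%act (pblock Pi x) a.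
Proof.
move=> [partPi actPi] Aa; apply: (pblockTE partPi).
  by rewrite (acts_act actPi Aa) pblock_partT.
by apply: imset_f; apply: mem_pblockT.
Qed.

Lemma invariant_preim A (rT : eqType) (f : T -> rT) :
    (forall a x y, a \in A -> f x = f y -> f (to x a) = f (to y a)) ->
  invariant_partition to A (preim_partition f [set: T]).
Proof.
move=> invf; have partPi := preim_partitionP f [set: T].
split=> //; apply/actsP=> a Aa P.
have sub b Q : b \in A -> Q \in preim_partition f [set: T] ->
    (to^*)%act Q b \in preim_partition f [set: T].
  move=> Ab PiQ; have /set0Pn[x Qx]: Q != set0.
    by apply: contraTneq PiQ => ->; case/and3P: partPi.
  rewrite -(pblockTE partPi PiQ Qx).
  suff ->: (to^*)%act (pblock (preim_partition f setT) x) b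
           = pblock (preim_partition f setT) (to x b) by exact: pblock_partT.
  apply/setP=> y; rewrite -[y](actKV to b) [LHS]mem_imset; last exact: act_inj.
  rewrite !mem_preim_pblock.
  apply/eqP/eqP=> [/(invf _ _ _ Ab) // | eqf].
  by have := invf b^-1 _ _ (groupVr Ab) eqf; rewrite !actK.
apply/idP/idP=> [PiPa | /(sub _ _ Aa) //].
by have := sub a^-1 _ (groupVr Aa) PiPa; rewrite actK.
Qed.

Lemma orbit_partition_pblock A Pi :
    partition Pi [set: T] ->
    (forall x y, y \in pblock Pi x = (y \in orbit to A x)) ->
  Pi = Defs.orbit_partition to A.
Proof.
move=> partPi eqPi; have pblockE x : pblock Pi x = orbit to A x by apply/setP.
apply/setP=> P; apply/idP/imsetP=> [PiP | [x _ ->]].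
  have /set0Pn[x Px]: P != set0.
    by apply: contraTneq PiP => ->; case/and3P: partPi.
  by exists x; rewrite // -pblockE (pblockTE partPi PiP Px).
by rewrite -pblockE pblock_partT.
Qed.

(** Invariant partitions enter the argument as kernels of functions, typically
of the function sending a point to the part containing it; this form of
pre-primitivity spares the conversion between the two. *)
Lemma preprimitive_kernel A (rT : eqType) (f : T -> rT) :
    preprimitive to A ->
    (forall a x y, a \in A -> f x = f y -> f (to x a) = f (to y a)) ->
  exists2 K : {group aT}, K \subset A &
    forall x y, (y \in orbit to K x) = (f x == f y).
Proof.
case=> _ ppA /invariant_preim invPi.
have [K [sKA defPi]] := ppA _ invPi; exists K => // x y.
rewrite -mem_preim_pblock (@pblockTE _ _ _ x (orbit to K x)) //.
- exact: (preim_partitionP f [set: T]).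
- by rewrite defPi imset_f.
- exact: orbit_refl.
Qed.

End Actions.

(** * Invariant partitions of a product *)

Section Product.

Variables (aT bT : finGroupType) (S T : finType).
Variables (to1 : {action aT &-> S}) (to2 : {action bT &-> T}).
Variables (G : {group aT}) (H : {group bT}).

Local Notation to := (prod_action to1 to2).
Local Notation GH := (setX_group G H).

Lemma atrans_prod :
    [transitive G, on [set: S] | to1] -> [transitive H, on [set: T] | to2] ->
  [transitive GH, on [set: S * T] | to].
Proof.
case/imsetP=> c _ trG /imsetP[d _ trH].
apply/imsetP; exists (c, d); rewrite ?inE //.
apply/esym/setP=> -[c' d']; rewrite inE.
have /orbitP[g Gg defc]: c' \in orbit to1 G c by rewrite -trG inE.
have /orbitP[h Hh defd]: d' \in orbit to2 H d by rewrite -trH inE.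
apply/orbitP; exists (g, h); first by rewrite inE /= Gg.
by rewrite /= /prodact /= defc defd.
Qed.

Variable Pi : {set {set S * T}}.
Hypothesis invPi : invariant_partition to GH Pi.

Let partPi : partition Pi [set: S * T]. Proof. by case: invPi. Qed.

Lemma eq_pblock_act g h c d c' d' : g \in G -> h \in H ->
    pblock Pi (c, d) = pblock Pi (c', d') ->
  pblock Pi (to1 c g, to2 d h) = pblock Pi (to1 c' g, to2 d' h).
Proof.
move=> Gg Hh eqcd; have GHgh : (g, h) \in GH by rewrite inE /= Gg.
have /= E x := pblock_act x invPi GHgh.
by move: (E (c, d)) (E (c', d')); rewrite /prodact /= eqcd => -> ->.
Qed.

(** The fibre partition does not depend on the line on which it is taken: an
element of H carries one line to the other and fixes first coordinates. *)
Lemma eq_pblock_indep1 c c' d d' : [transitive H, on [set: T] | to2] ->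
    pblock Pi (c, d) = pblock Pi (c', d) ->
  pblock Pi (c, d') = pblock Pi (c', d').
Proof.
move=> trH; have [h Hh ->] := atransP2 trH (in_setT d) (in_setT d').
by move/(eq_pblock_act (group1 G) Hh); rewrite !act1.
Qed.

Lemma eq_pblock_indep2 c c' d d' : [transitive G, on [set: S] | to1] ->
    pblock Pi (c, d) = pblock Pi (c, d') ->
  pblock Pi (c', d) = pblock Pi (c', d').
Proof.
move=> trG; have [g Gg ->] := atransP2 trG (in_setT c) (in_setT c').
by move/(fun Gg => eq_pblock_act Gg (group1 H)): Gg => E /E; rewrite !act1.
Qed.

(** Two points of one part have first coordinates in one part of the projection
partition; when this is also a part of a fibre partition, the two coordinates
are already related on a single line.  This is what makes parts into boxes. *)
Lemma fibre1_projection c c' d d' : fibre1 Pi d = projection1 Pi ->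
    pblock Pi (c, d) = pblock Pi (c', d') ->
  pblock Pi (c, d) = pblock Pi (c', d).
Proof.
move=> eqF eqcd; set P := pblock Pi (c, d).
have: [set x | [exists y, (x, y) \in P]] \in projection1 Pi.
  by apply: imset_f; apply: pblock_partT.
rewrite -eqF => /setD1P[_ /imsetP[Q PiQ /setP defQ]].
have Qd x y : (x, y) \in P -> (x, d) \in Q.
  by move=> Pxy; move: (defQ x); rewrite !inE => <-; apply/existsP; exists y.
rewrite /P (pblockTE partPi PiQ (Qd c d _)) ?mem_pblockT //.
by rewrite (pblockTE partPi PiQ (Qd c' d' _)) // /P eqcd mem_pblockT.
Qed.

Lemma fibre2_projection c c' d d' : fibre2 Pi c = projection2 Pi ->
    pblock Pi (c, d) = pblock Pi (c', d') ->
  pblock Pi (c, d) = pblock Pi (c, d').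
Proof.
move=> eqF eqcd; set P := pblock Pi (c, d).
have: [set y | [exists x, (x, y) \in P]] \in projection2 Pi.
  by apply: imset_f; apply: pblock_partT.
rewrite -eqF => /setD1P[_ /imsetP[Q PiQ /setP defQ]].
have Qc x y : (x, y) \in P -> (c, y) \in Q.
  by move=> Pxy; move: (defQ y); rewrite !inE => <-; apply/existsP; exists x.
rewrite /P (pblockTE partPi PiQ (Qc c d _)) ?mem_pblockT //.
by rewrite (pblockTE partPi PiQ (Qc c' d' _)) // /P eqcd mem_pblockT.
Qed.

(** One moves from (c, d) to (c', d') inside a part by changing one coordinate
at a time; each change stays in a fibre, hence in an orbit of K1 or of K2. *)
Lemma type_i_orbit_partition :
    preprimitive to1 G -> preprimitive to2 H -> type_i Pi ->
  exists K : {group aT * bT}, K \subset GH /\ Pi = Defs.orbit_partition to K.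
Proof.
move=> ppG ppH [fib1 fib2]; have [trG _] := ppG; have [trH _] := ppH.
have [/imsetP[c0 _ _] /imsetP[d0 _ _]] := (trG, trH).
have [|K1 sK1G orbK1] := @preprimitive_kernel _ _ to1 G _
  (fun c => pblock Pi (c, d0)) ppG.
  move=> a x y Ga; move/(eq_pblock_act Ga (group1 H)).
  by rewrite !act1.
have [|K2 sK2H orbK2] := @preprimitive_kernel _ _ to2 H _
  (fun d => pblock Pi (c0, d)) ppH.
  move=> a x y Ha; move/(eq_pblock_act (group1 G) Ha).
  by rewrite !act1.
exists (setX_group K1 K2); split; first exact: setXS.
apply: orbit_partition_pblock => // -[c d] [c' d'].
rewrite -eq_pblockT //; apply/eqP/orbitP=> [eqcd | [[g h]]].
  have /orbitP[g Kg defc]: c' \in orbit to1 K1 c.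
    rewrite orbK1; apply/eqP/(eq_pblock_indep1 d0 trH (d := d)).
    exact: fibre1_projection (fib1 d) eqcd.
  have /orbitP[h Kh defd]: d' \in orbit to2 K2 d.
    rewrite orbK2; apply/eqP/(eq_pblock_indep2 c0 trG (c := c)).
    exact: fibre2_projection (fib2 c) eqcd.
  by exists (g, h); rewrite ?inE /= ?Kg // /prodact /= defc defd.
rewrite inE /= => /andP[Kg Kh] [<- <-].
have /eqP: pblock Pi (c, d0) == pblock Pi (to1 c g, d0).
  by rewrite -orbK1 mem_orbit.
move/(eq_pblock_indep1 d trH) => ->.
have /eqP: pblock Pi (c0, d) == pblock Pi (c0, to2 d h).
  by rewrite -orbK2 mem_orbit.
exact: eq_pblock_indep2.
Qed.

Lemma projection1_full P c : projection1 Pi = [set [set: S]] -> P \in Pi ->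
  exists d, (c, d) \in P.
Proof.
move=> full PiP; apply/existsP.
have: [set x | [exists y, (x, y) \in P]] \in projection1 Pi by apply: imset_f.
by rewrite full => /set1P/setP/(_ c); rewrite !inE.
Qed.

Lemma projection2_full P d : projection2 Pi = [set [set: T]] -> P \in Pi ->
  exists c, (c, d) \in P.
Proof.
move=> full PiP; apply/existsP.
have: [set y | [exists x, (x, y) \in P]] \in projection2 Pi by apply: imset_f.
by rewrite full => /set1P/setP/(_ d); rewrite !inE.
Qed.

End Product.

(** * Partitions with full projections *)

Section FullProjections.

Variables (aT bT : finGroupType) (S T : finType).
Variables (to1 : {action aT &-> S}) (to2 : {action bT &-> T}).
Variables (G : {group aT}) (H : {group bT}).

Local Notation to := (prod_action to1 to2).
Local Notation GH := (setX_group G H).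

Hypothesis trG : [transitive G, on [set: S] | to1].
Hypothesis trH : [transitive H, on [set: T] | to2].

Hypothesis types : forall Pi : {set {set S * T}},
  invariant_partition to GH Pi -> type_i Pi \/ type_ii Pi.

Variable Pi : {set {set S * T}}.
Hypothesis invPi : invariant_partition to GH Pi.
Hypothesis fullPi : type_ii Pi.

Let partPi : partition Pi [set: S * T]. Proof. by case: invPi. Qed.

(** The hypothesis on types is applied to the meet of Pi with the kernel of f,
pulled back to S x T.  As Pi has full projections, every part of the meet
projects onto a whole class of f.  If the projection is all of T, then f is
constant; if the projection is also a fibre, then a class of f lies inside a
fibre of Pi. *)
Lemma invariant_kernel_dichotomy (rT : eqType) (f : T -> rT) :
    (forall h d d', h \in H -> f d = f d' -> f (to2 d h) = f (to2 d' h)) ->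
    (forall d d', f d = f d')
  \/ (forall c d d', f d = f d' -> pblock Pi (c, d) = pblock Pi (c, d')).
Proof.
move=> invf; pose F (x : S * T) := (pblock Pi x, f x.2).
pose Pi' := preim_partition F [set: S * T].
have invPi' : invariant_partition to GH Pi'.
  apply: invariant_preim => -[g h] [c d] [c' d'] /setXP[/= Gg Hh] [eqcd eqf].
  by congr (_, _); [apply: (eq_pblock_act invPi) | apply: invf].
have [partPi' _] := invPi'.
have eqPi' x y : (pblock Pi' x == pblock Pi' y) = (F x == F y).
  by rewrite eq_pblockT // mem_preim_pblock.
case: (types invPi') => [[_ fib2] | [_ full2]]; [right | left].
  (* A point of the part of (c, d) in Pi with second coordinate d' is in the
     same part of the meet, because f d = f d'. *)
  move=> c d d' eqf; have [_ full2] := fullPi.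
  have [c' Pc'd'] := projection2_full d' full2 (pblock_partT partPi (c, d)).
  have /eqP: pblock Pi' (c, d) == pblock Pi' (c', d').
    by rewrite eqPi' xpair_eqE eq_pblockT // Pc'd' /= eqf.
  move/(fibre2_projection invPi' (fib2 c))/eqP.
  by rewrite eqPi' => /eqP[].
move=> d d'; have /imsetP[c _ _] := trG.
have [c'] := projection2_full d' full2 (pblock_partT partPi' (c, d)).
by rewrite mem_preim_pblock => /eqP[].
Qed.

(** A line {c} x T meets every part, so the parts can be indexed by T. *)
Lemma part_pblock c P : P \in Pi -> exists d, P = pblock Pi (c, d).
Proof.
have [full1 _] := fullPi => PiP.
have [d Pcd] := projection1_full c full1 PiP.
by exists d; rewrite (pblockTE partPi PiP Pcd).
Qed.

Lemma commute_factors (g : aT) (h : bT) : commute (g, 1 : bT) (1 : aT, h).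
Proof. by congr (_, _); rewrite /= ?mulg1 ?mul1g. Qed.

Lemma setact_part P a : P \in Pi -> a \in GH -> (to^*)%act P a \in Pi.
Proof. by case: invPi => _ actPi PiP GHa; rewrite (acts_act actPi GHa). Qed.

Lemma setact_pblock1 c d h : h \in H ->
  pblock Pi (c, to2 d h) = (to^*)%act (pblock Pi (c, d)) (1, h).
Proof.
move=> Hh; have GHh : (1, h) \in GH by rewrite inE /= group1.
by rewrite -(pblock_act _ invPi GHh) /= /prodact /= act1.
Qed.

Lemma transitive2_parts P Q : P \in Pi -> Q \in Pi ->
  exists2 h, h \in H & Q = (to^*)%act P (1, h).
Proof.
have /imsetP[c _ _] := trG.
move=> /(part_pblock c)[d ->] /(part_pblock c)[d' ->].
have [h Hh ->] := atransP2 trH (in_setT d) (in_setT d').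
by exists h => //; rewrite setact_pblock1.
Qed.

(** The group L induced on the parts has no proper nontrivial cyclic subgroup.
The element g defines a partition of T, even though it acts on S: identify T
with a line {c} x T and relate points whose parts are in one orbit of g.  It is
H-invariant because G and H commute. *)
Lemma trivial_or_cycle_transitive g : g \in G ->
    (forall P, P \in Pi -> (to^*)%act P (g, 1) = P)
  \/ (forall P Q, P \in Pi -> Q \in Pi ->
       exists i, Q = (to^*)%act P ((g, 1) ^+ i)).
Proof.
move=> Gg; have /imsetP[c _ _] := trG.
have GHg : (g, 1) \in GH by rewrite inE /= Gg group1.
pose C := <[(g, 1 : bT)]>; pose f d := orbit (to^*) C (pblock Pi (c, d)).
have invf h d d' : h \in H -> f d = f d' -> f (to2 d h) = f (to2 d' h).
  move=> Hh /orbit_eqP/orbitP[_ /cycleP[i ->] eqd]; apply/orbit_eqP/orbitP.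
  exists ((g, 1) ^+ i); first exact: mem_cycle.
  rewrite !setact_pblock1 // -eqd -!actM.
  by rewrite (commuteX i (commute_sym (commute_factors g h))).
(* Constancy of f is transitivity of g on the parts.  Otherwise a part and its
   image under g are related by f, hence equal; H being transitive on the parts,
   one fixed part is enough. *)
case: (invariant_kernel_dichotomy invf) => [allf | reff]; [right | left].
  move=> _ _ /(part_pblock c)[d ->] /(part_pblock c)[d' ->].
  have /orbit_eqP/orbitP[_ /cycleP[i ->] <-] := allf d' d.
  by exists i.
have /imsetP[d0 _ _] := trH; pose P0 := pblock Pi (c, d0).
have PiP0 : P0 \in Pi by apply: pblock_partT.
have fixP0 : (to^*)%act P0 (g, 1) = P0.
  have [d defd] := part_pblock c (setact_part PiP0 GHg).
  rewrite defd; apply: reff; apply/orbit_eqP.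
  by rewrite -defd mem_orbit ?cycle_id.
move=> _ /(transitive2_parts PiP0)[h _ ->].
by rewrite -actM -commute_factors actM fixP0.
Qed.

(** The action of g on the parts is inverted by an element of H.  If g is not
trivial, take h undoing g on one part P; every part is P moved by a power of g,
which commutes with both g and h, so h undoes g everywhere. *)
Lemma kernel_lift g : g \in G ->
  exists2 h, h \in H & (g, h) \in 'C_GH(Pi | to^*).
Proof.
move=> Gg; have GHg : (g, 1) \in GH by rewrite inE /= Gg group1.
have [fixPi | trPi] := trivial_or_cycle_transitive Gg.
  by exists 1 => //; rewrite inE GHg; apply/astabP.
have [/imsetP[c _ _] /imsetP[d _ _]] := (trG, trH).
pose P := pblock Pi (c, d); have PiP : P \in Pi by apply: pblock_partT.
have [h Hh defP] := transitive2_parts (setact_part PiP GHg) PiP.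
exists h => //; rewrite inE in_setX Gg Hh; apply/astabP=> Q PiQ.
have ->: (g, h) = (g, 1) * (1, h) by congr (_, _); rewrite /= ?mulg1 ?mul1g.
have [i ->] := trPi P Q PiP PiQ.
rewrite -actM mulgA -expgSr expgS -mulgA.
rewrite -(commuteX i (commute_sym (commute_factors g h))).
by rewrite mulgA !actM -defP.
Qed.

(** The kernel of the action on the parts is transitive on each part: lift g to
the kernel, then correct the second coordinate inside a fibre. *)
Lemma type_ii_orbit_partition : preprimitive to2 H ->
  exists K : {group aT * bT}, K \subset GH /\ Pi = Defs.orbit_partition to K.
Proof.
move=> ppH; exists ('C_GH(Pi | to^*))%G; split; first exact: subsetIl.
apply: orbit_partition_pblock => // -[c d] [c' d'].
rewrite -eq_pblockT //.
apply/eqP/orbitP=> [eqcd | [a /setIP[GHa /astabP fixa] <-]].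
  have [g Gg defc] := atransP2 trG (in_setT c) (in_setT c').
  have [h Hh Kgh] := kernel_lift Gg.
  have [|K2 sK2H orbK2] := @preprimitive_kernel _ _ to2 H _
    (fun y => pblock Pi (c', y)) ppH.
    move=> b x y Hb; move/(eq_pblock_act invPi (group1 G) Hb).
    by rewrite !act1.
  have /orbitP[k Kk defd]: d' \in orbit to2 K2 (to2 d h).
    rewrite orbK2 -eqcd {1}defc; have [GHgh /astabP fixgh] := setIP Kgh.
    by rewrite (pblock_act (c, d) invPi GHgh) fixgh ?pblock_partT.
  exists ((g, h) * (1, k)); last first.
    by rewrite actM /= /prodact /= act1 defd -defc.
  (* k preserves the fibres on the line {c'} x T, which meets every part. *)
  have Hk := subsetP sK2H k Kk.
  rewrite groupM // inE in_setX group1 Hk; apply/astabP=> Q.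
  case/(part_pblock c')=> y ->; rewrite -setact_pblock1 //.
  by apply/esym/eqP; rewrite -orbK2 mem_orbit.
by rewrite (pblock_act _ invPi GHa) fixa ?pblock_partT.
Qed.

End FullProjections.

Theorem theorem2p10 (Gamma Delta : finType)
    (G : {group {perm Gamma}}) (H : {group {perm Delta}}) :
  preprimitive 'P G ->
  preprimitive 'P H ->
  (forall Pi : {set {set Gamma * Delta}},
     invariant_partition (prod_action 'P 'P) (setX G H) Pi ->
     type_i Pi \/ type_ii Pi) ->
  preprimitive (prod_action 'P 'P) (setX G H).
Proof.
move=> ppG ppH types; have [[trG _] [trH _]] := (ppG, ppH).
split=> [|Pi invPi]; first exact: atrans_prod.
case: (types Pi invPi) => [typePi | typePi].
  exact: type_i_orbit_partition.
exact: (type_ii_orbit_partition trG trH types).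
Qed.
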